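(* Let $0\to\mathfrak{a}\xrightarrow{i}\mathfrak{h}\xrightarrow{p}\mathfrak{g}\to0$ be a central extension of Leibniz algebras. A pair of derivations $(\phi_\mathfrak{g},\phi_\mathfrak{a})\in\mathrm{Der}(\mathfrak{g})\times\mathrm{Der}(\mathfrak{a})$ is extensible if and only if the obstruction class $[\mathrm{Ob}^\mathfrak{h}_{(\phi_\mathfrak{g},\phi_\mathfrak{a})}]\in H^2(\mathfrak{g},\mathfrak{a})$ is trivial.
   Context: All vector spaces and linear maps are over a field $\mathbb{K}$ of characteristic zero. A (right) Leibniz algebra is a vector space with a bilinear bracket satisfying $[[x,y],z]=[[x,z],y]+[x,[y,z]]$; $\mathrm{Der}(\mathfrak{g})$ is the set of linear maps $\phi:\mathfrak{g}\to\mathfrak{g}$ with $\phi[x,y]=[\phi(x),y]+[x,\phi(y)]$. A central extension $0\to\mathfrak{a}\xrightarrow{i}\mathfrak{h}\xrightarrow{p}\mathfrak{g}\to0$ is an exact sequence of Leibniz algebras with $\mathfrak{a}$ abelian (zero bracket) and $[i(a),h]=0=[h,i(a)]$ for all $a\in\mathfrak{a}$, $h\in\mathfrak{h}$. The pair $(\phi_\mathfrak{g},\phi_\mathfrak{a})$ is extensible if there is $\phi_\mathfrak{h}\in\mathrm{Der}(\mathfrak{h})$ making $0\to(\mathfrak{a},\phi_\mathfrak{a})\xrightarrow{i}(\mathfrak{h},\phi_\mathfrak{h})\xrightarrow{p}(\mathfrak{g},\phi_\mathfrak{g})\to0$ an exact sequence of LeibDer pairs (Leibniz algebras with a derivation),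 i.e. $\phi_\mathfrak{h}\circ i=i\circ\phi_\mathfrak{a}$ and $p\circ\phi_\mathfrak{h}=\phi_\mathfrak{g}\circ p$. Choose a linear section $s:\mathfrak{g}\to\mathfrak{h}$ of $p$ ($p\circ s=\mathrm{id}_\mathfrak{g}$), identify $\mathfrak{a}$ with $i(\mathfrak{a})$, and let $\psi(x,y)=[s(x),s(y)]-s[x,y]\in\mathfrak{a}$. Define $\mathrm{Ob}^\mathfrak{h}_{(\phi_\mathfrak{g},\phi_\mathfrak{a})}:\mathfrak{g}^{\otimes2}\to\mathfrak{a}$ by $$\mathrm{Ob}^\mathfrak{h}_{(\phi_\mathfrak{g},\phi_\mathfrak{a})}(x,y)=\phi_\mathfrak{a}(\psi(x,y))-\psi(\phi_\mathfrak{g}(x),y)-\psi(x,\phi_\mathfrak{g}(y)).$$ This is a 2-cocycle in the Leibniz cohomology of $\mathfrak{g}$ with coefficients in the trivial representation $\mathfrak{a}$, whose class (the obstruction class) is independent of $s$. Here $H^n(\mathfrak{g},\mathfrak{a})$ is the $n$-th cohomology of the complex $\mathrm{Hom}(\mathfrak{g}^{\otimes n},\mathfrak{a})$ with differential $$(\delta_Lf)(x_1,\ldots,x_{n+1})=\sum_{i<j}(-1)^{j+1}f(x_1,\ldots,x_{i-1},[x_i,x_j],x_{i+1},\ldots,\widehat{x_j},\ldots,x_{n+1}).$$ *)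

(* Defs.v *)
From HB Require Import structures.
From mathcomp Require Import all_boot all_order all_algebra.
From mathcomp Require Import ring_quotient.
From mathcomp Require Import boolp classical_sets functions.

Set Implicit Arguments.
Unset Strict Implicit.
Unset Printing Implicit Defensive.

Import GRing.Theory.
Local Open Scope ring_scope.
Local Open Scope quotient_scope.
Local Open Scope classical_set_scope.

(* Right Leibniz algebras over a field, of arbitrary dimension. *)
HB.mixin Record Lmodule_isLeibniz (K : fieldType) V of GRing.Lmodule K V := {
  bracket : V -> V -> V;
  bracket_linearl : forall y, linear (bracket^~ y);
  bracket_linearr : forall x, linear (bracket x);
  leibniz_identity : forall x y z,
    bracket (bracket x y) z = bracket (bracket x z) y + bracket x (bracket y z)
}.

#[short(type="leibnizType")]
HB.structure Definition Leibniz (K : fieldType) :=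
  {V of GRing.Lmodule K V & Lmodule_isLeibniz K V}.

Section BracketTheory.
Context {K : fieldType} {V : leibnizType K}.
Implicit Types x y z : V.

Lemma bracketDl x y z : bracket (x + y) z = bracket x z + bracket y z.
Proof. by have := bracket_linearl z 1 x y; rewrite !scale1r. Qed.

Lemma bracketDr x y z : bracket x (y + z) = bracket x y + bracket x z.
Proof. by have := bracket_linearr x 1 y z; rewrite !scale1r. Qed.

Lemma bracket0l x : bracket 0 x = 0.
Proof. by apply: (addrI (bracket 0 x)); rewrite -bracketDl !addr0. Qed.

Lemma bracket0r x : bracket x 0 = 0.
Proof. by apply: (addrI (bracket x 0)); rewrite -bracketDr !addr0. Qed.

Lemma bracketZl c x y : bracket (c *: x) y = c *: bracket x y.
Proof. by have := bracket_linearl y c x 0; rewrite bracket0l !addr0. Qed.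

Lemma bracketZr c x y : bracket x (c *: y) = c *: bracket x y.
Proof. by have := bracket_linearr x c y 0; rewrite bracket0r !addr0. Qed.

Lemma bracketNl x y : bracket (- x) y = - bracket x y.
Proof. by rewrite -scaleN1r bracketZl scaleN1r. Qed.

Lemma bracketNr x y : bracket x (- y) = - bracket x y.
Proof. by rewrite -scaleN1r bracketZr scaleN1r. Qed.

End BracketTheory.

Definition leibniz_morphism (K : fieldType) (V W : leibnizType K)
  (f : V -> W) : Prop := {morph f : x y / bracket x y}.

Definition abelian_leibniz (K : fieldType) (V : leibnizType K) : Prop :=
  forall x y : V, bracket x y = 0.

Definition derivation (K : fieldType) (V : leibnizType K) (f : V -> V) : Prop :=
  forall x y, f (bracket x y) = bracket (f x) y + bracket x (f y).

Record Der (K : fieldType) (V : leibnizType K) := MkDer {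
  der_map :> {linear V -> V};
  derP : derivation der_map
}.

Record central_extension (K : fieldType) (a h g : leibnizType K) := CentralExt {
  ext_i : {linear a -> h};
  ext_p : {linear h -> g};
  ext_i_morph : leibniz_morphism ext_i;
  ext_p_morph : leibniz_morphism ext_p;
  ext_i_inj : injective ext_i;
  ext_exact : forall y, ext_p y = 0 <-> exists u, ext_i u = y;
  ext_p_surj : forall x, exists y, ext_p y = x;
  ext_abelian : abelian_leibniz a;
  ext_centrall : forall u y, bracket (ext_i u) y = 0;
  ext_centralr : forall u y, bracket y (ext_i u) = 0
}.

Definition extensible (K : fieldType) (a h g : leibnizType K)
    (E : central_extension a h g) (phig : Der g) (phia : Der a) : Prop :=
  exists phih : Der h,
    (forall u, phih (ext_i E u) = ext_i E (phia u)) /\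
    (forall y, ext_p E (phih y) = phig (ext_p E y)).

Section Cohomology.
Context {K : fieldType}.

(* The family x with its k-th entry replaced by u. *)
Definition upd (T : Type) (n : nat) (x : 'I_n -> T) (k : 'I_n) (u : T) :
  'I_n -> T := fun l => if l == k then u else x l.

Definition multilinear (V W : lmodType K) (n : nat) (f : ('I_n -> V) -> W) :
    Prop :=
  forall (x : 'I_n -> V) (k : 'I_n), linear (fun u => f (upd x k u)).

Definition multilinearb (V W : lmodType K) (n : nat) :
  {pred (('I_n -> V) -> W)} := fun f => `[< multilinear f >].

Lemma fct_linE (T : Type) (W : lmodType K) (c : K) (f1 f2 : T -> W) x :
  (c *: f1 + f2) x = c *: f1 x + f2 x.
Proof. by []. Qed.

Lemma multilinear_submod (V W : lmodType K) n :
  submod_closed (@multilinearb V W n).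
Proof.
split.
  by apply/asboolP => x k c u v; rewrite /= scaler0 addr0.
move=> c f1 f2 /asboolP f1P /asboolP f2P; apply/asboolP => x k d u v.
by rewrite !fct_linE f1P f2P !scalerDr !scalerA mulrC addrACA.
Qed.

HB.instance Definition _ (V W : lmodType K) n :=
  GRing.isSubmodClosed.Build K (('I_n -> V) -> W) (@multilinearb V W n)
    (@multilinear_submod V W n).

(* Hom(g^{⊗n}, a), as multilinear maps. *)
Record cochain (g a : leibnizType K) (n : nat) := MkCochain {
  cochain_fun :> ('I_n -> g) -> a;
  cochainP : multilinearb cochain_fun
}.

HB.instance Definition _ g a n := [isSub for @cochain_fun g a n].
HB.instance Definition _ g a n := [Choice of cochain g a n by <:].
HB.instance Definition _ g a n :=
  [SubChoice_isSubLmodule of cochain g a n by <:].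

Section Differential.
Variables g a : leibnizType K.

(* (x_1, ..., x_{i-1}, [x_i,x_j], x_{i+1}, ..., omit x_j, ..., x_{n+1}) *)
Definition contract n (x : 'I_n.+1 -> g) (i j : 'I_n.+1) : 'I_n -> g :=
  fun k => upd x i (bracket (x i) (x j)) (lift j k).

(* Indices start at 0 here, so the sign (-1)^(j+1) becomes (-1)^j. *)
Definition delta_fun n (f : ('I_n -> g) -> a) (x : 'I_n.+1 -> g) : a :=
  \sum_(j < n.+1) \sum_(i < n.+1 | (i < j)%N)
    (-1) ^+ j *: f (contract x i j).

Lemma upd_lift n (x : 'I_n.+1 -> g) (j : 'I_n.+1) (k : 'I_n) u :
  (fun l => upd x (lift j k) u (lift j l)) = upd (x \o lift j) k u.
Proof.
by apply/funext => l; rewrite /upd (inj_eq lift_inj).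
Qed.

Lemma contractE n (x : 'I_n.+1 -> g) (i j : 'I_n.+1) (k : 'I_n) :
  lift j k = i ->
  contract x i j = upd (x \o lift j) k (bracket (x i) (x j)).
Proof. by move=> <-; rewrite -upd_lift. Qed.

Lemma contract_upd n (x : 'I_n.+1 -> g) (i j k : 'I_n.+1) : i != j ->
  exists (y : 'I_n -> g) (m : 'I_n) (L : g -> g),
    linear L /\ forall w, contract (upd x k w) i j = upd y m (L w).
Proof.
move=> iNj; have jNi : j != i by rewrite eq_sym.
have [k' ik' _] := unlift_some jNi; have iE := esym ik'.
have [->|kNj] := eqVneq k j.
  exists (x \o lift j), k', (bracket (x i)); split.
    exact: bracket_linearr.
  move=> w; rewrite (contractE _ iE); apply/funext => l.
  by rewrite /upd /= eqxx (negbTE iNj) lift_eqF.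
have [->|kNi] := eqVneq k i.
  exists (x \o lift j), k', (bracket^~ (x j)); split.
    exact: bracket_linearl.
  move=> w; rewrite (contractE _ iE); apply/funext => l.
  rewrite /upd /= eqxx (negbTE jNi) -{1}iE (inj_eq lift_inj).
  by case: (l == k').
have jNk : j != k by rewrite eq_sym.
have [m km _] := unlift_some jNk.
have mNk' : m != k' by apply: contraNneq kNi => mk; rewrite km mk iE.
exists (upd (x \o lift j) k' (bracket (x i) (x j))), m, id; split=> // w.
rewrite (contractE _ iE); apply/funext => l.
rewrite /upd /= ![_ == k]eq_sym (negbTE kNi) (negbTE kNj) km (inj_eq lift_inj).
rewrite [m == l]eq_sym; case: (eqVneq l m) => [->|//].
by rewrite (negbTE mNk').
Qed.

Lemma delta_multilinear n (f : cochain g a n) : multilinearb (delta_fun f).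
Proof.
have /asboolP fP := cochainP f; apply/asboolP => x k c u v.
rewrite /delta_fun scaler_sumr -big_split; apply: eq_bigr => j _ /=.
rewrite scaler_sumr -big_split; apply: eq_bigr => i ij /=.
rewrite [c *: (_ *: _)]scalerA mulrC -scalerA -scalerDr; congr (_ *: _).
have [|y [m [L [L_lin cE]]]] := @contract_upd _ x i j k; first by rewrite neq_ltn ij.
by rewrite !cE L_lin fP.
Qed.

Definition delta n (f : cochain g a n) : cochain g a n.+1 :=
  MkCochain (delta_multilinear f).

Lemma delta_fun_linear n : linear (@delta_fun n).
Proof.
move=> c f1 f2; apply/funext => x.
rewrite fct_linE /delta_fun scaler_sumr -big_split.
apply: eq_bigr => j _ /=; rewrite scaler_sumr -big_split.
apply: eq_bigr => i _ /=.
by rewrite fct_linE scalerDr !scalerA mulrC.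
Qed.

Lemma delta_linear n : linear (@delta n).
Proof.
by move=> c f1 f2; apply/val_inj; rewrite linearP /= -delta_fun_linear.
Qed.

HB.instance Definition _ n :=
  GRing.isLinear.Build K (cochain g a n) (cochain g a n.+1) *:%R (@delta n)
    (@delta_linear n).

Definition is_cocycle n : {pred cochain g a n} := fun f => delta f == 0.

Lemma cocycle_submod n : submod_closed (@is_cocycle n).
Proof.
split; first by rewrite unfold_in /is_cocycle raddf0.
move=> c f1 f2 /eqP f1Z /eqP f2Z; apply/eqP.
by rewrite linearP /= f1Z f2Z scaler0 addr0.
Qed.

HB.instance Definition _ n :=
  GRing.isSubmodClosed.Build K (cochain g a n) (@is_cocycle n)
    (@cocycle_submod n).

End Differential.

Record cocycle (g a : leibnizType K) (n : nat) := MkCocycle {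
  cocycle_val :> cochain g a n;
  cocycleP : is_cocycle cocycle_val
}.

HB.instance Definition _ g a n := [isSub for @cocycle_val g a n].
HB.instance Definition _ g a n := [Choice of cocycle g a n by <:].
HB.instance Definition _ g a n :=
  [SubChoice_isSubLmodule of cocycle g a n by <:].

Section Quotient.
Variables g a : leibnizType K.

(* A coboundary is always a cocycle since delta squares to zero; only cocycles
   that are coboundaries enter the quotient, so this fact is not needed here. *)
Definition is_coboundary n : cochain g a n -> Prop :=
  if n is m.+1 then fun f => exists c : cochain g a m, f = delta c
  else fun f => f = 0.

Definition coboundary n : {pred cocycle g a n} :=
  fun z => `[< is_coboundary (cocycle_val z) >].

Lemma coboundary_zmod n : zmod_closed (@coboundary n).
Proof.
split; first by apply/asboolP; case: n => //= n; exists 0; rewrite raddf0.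
move=> z1 z2 /asboolP z1P /asboolP z2P; apply/asboolP.
case: n => [|n] in z1 z2 z1P z2P *; first by rewrite /= z1P z2P subr0.
by case: z1P z2P => c1 z1E [c2 z2E]; exists (c1 - c2); rewrite /= z1E z2E raddfB.
Qed.

HB.instance Definition _ n :=
  GRing.isZmodClosed.Build (cocycle g a n) (@coboundary n) (@coboundary_zmod n).

Definition cohomology n : zmodType :=
  Quotient.quot (@coboundary n : zmodClosed (cocycle g a n)).

Definition cohomology_class n (z : cocycle g a n) : cohomology n :=
  \pi_(Quotient.quot (@coboundary n : zmodClosed (cocycle g a n))) z.

End Quotient.
End Cohomology.

Section Obstruction.
Context {K : fieldType} {a h g : leibnizType K}.
Implicit Types E : central_extension a h g.

Record linear_section E := MkSection {
  section_map :> {linear g -> h};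
  sectionP : cancel section_map (ext_p E)
}.

(* [s x, s y] - s [x, y] pulled back along i, which identifies a with i(a);
   the default value 0 is never used, see psiP. *)
Definition psi E (s : linear_section E) (x y : g) : a :=
  xget 0 [set u | ext_i E u = bracket (s x) (s y) - s (bracket x y)].

Definition Ob E (s : linear_section E) (phig : Der g) (phia : Der a) (x y : g) :
    a :=
  phia (psi s x y) - psi s (phig x) y - psi s x (phig y).

Lemma psiP E (s : linear_section E) x y :
  ext_i E (psi s x y) = bracket (s x) (s y) - s (bracket x y).
Proof.
have [u uE] : exists u, ext_i E u = bracket (s x) (s y) - s (bracket x y).
  by apply/ext_exact; rewrite linearB /= ext_p_morph !sectionP subrr.
by rewrite /psi; case: xgetP => [v _ //|/(_ u)[]].
Qed.

Lemma psi_linearl E (s : linear_section E) y : linear (psi s ^~ y).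
Proof.
move=> c x1 x2; apply: (@ext_i_inj _ _ _ _ E); rewrite linearP !psiP.
rewrite !(linearP, bracketDl, bracketZl) /=.
by rewrite scalerDr addrACA.
Qed.

Lemma psi_linearr E (s : linear_section E) x : linear (psi s x).
Proof.
move=> c x1 x2; apply: (@ext_i_inj _ _ _ _ E); rewrite linearP !psiP.
rewrite !(linearP, bracketDr, bracketZr) /=.
by rewrite scalerDr addrACA.
Qed.

Lemma psi_bracketl E (s : linear_section E) u v w :
  ext_i E (psi s (bracket u v) w) =
    bracket (bracket (s u) (s v)) (s w) - s (bracket (bracket u v) w).
Proof.
have -> : bracket (s u) (s v) = ext_i E (psi s u v) + s (bracket u v).
  by rewrite psiP subrK.
by rewrite bracketDl ext_centrall add0r psiP.
Qed.

Lemma psi_bracketr E (s : linear_section E) u v w :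
  ext_i E (psi s u (bracket v w)) =
    bracket (s u) (bracket (s v) (s w)) - s (bracket u (bracket v w)).
Proof.
have -> : bracket (s v) (s w) = ext_i E (psi s v w) + s (bracket v w).
  by rewrite psiP subrK.
by rewrite bracketDr ext_centralr add0r psiP.
Qed.

Lemma psi_cocycle E (s : linear_section E) x y z :
  psi s (bracket x y) z = psi s (bracket x z) y + psi s x (bracket y z).
Proof.
apply: (@ext_i_inj _ _ _ _ E); rewrite linearD /= psi_bracketr !psi_bracketl.
by rewrite leibniz_identity [bracket (bracket x y) z]leibniz_identity linearD /=
  opprD addrACA.
Qed.

Lemma Ob_linearl E (s : linear_section E) phig phia y :
  linear (Ob s phig phia ^~ y).
Proof.
move=> c x1 x2; rewrite /Ob !(linearP, psi_linearl) /=.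
by rewrite !scalerDr !addrA [LHS](ACl (1*3*5*2*4*6)%AC).
Qed.

Lemma Ob_linearr E (s : linear_section E) phig phia x :
  linear (Ob s phig phia x).
Proof.
move=> c x1 x2; rewrite /Ob !(linearP, psi_linearr) /=.
by rewrite !scalerDr !addrA [LHS](ACl (1*3*5*2*4*6)%AC).
Qed.

Lemma Ob_cocycle E (s : linear_section E) phig phia x y z :
  Ob s phig phia (bracket x y) z =
    Ob s phig phia (bracket x z) y + Ob s phig phia x (bracket y z).
Proof.
have psiDl u v w : psi s (u + v) w = psi s u w + psi s v w.
  by have := psi_linearl s w 1 u v; rewrite !scale1r.
have psiDr u v w : psi s u (v + w) = psi s u v + psi s u w.
  by have := psi_linearr s u 1 v w; rewrite !scale1r.
rewrite /Ob !derP !(psiDl, psiDr) (psi_cocycle s x y z).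
rewrite (psi_cocycle s (phig x) y z) (psi_cocycle s x (phig y) z).
rewrite (psi_cocycle s x y (phig z)) linearD /= !opprD !addrA.
by rewrite [RHS](ACl (1*5*2*6*4*7*3*8)%AC).
Qed.

Definition Ob_fun E (s : linear_section E) (phig : Der g) (phia : Der a)
  (x : 'I_2 -> g) : a := Ob s phig phia (x ord0) (x ord_max).

Lemma Ob_fun_multilinear E (s : linear_section E) phig phia :
  multilinearb (Ob_fun s phig phia).
Proof.
apply/asboolP => x [[|[|//]] lt2] c u v; rewrite /Ob_fun /upd /=.
  exact: Ob_linearl.
exact: Ob_linearr.
Qed.

Definition Ob_cochain E (s : linear_section E) (phig : Der g) (phia : Der a) :
  cochain g a 2 := MkCochain (Ob_fun_multilinear s phig phia).

Lemma Ob_cochain_cocycle E (s : linear_section E) phig phia :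
  is_cocycle (Ob_cochain s phig phia).
Proof.
apply/eqP/val_inj/funext => x.
rewrite /= /delta_fun; under eq_bigr do rewrite big_mkcond.
rewrite !big_ord_recr !big_ord0 /= !(addr0, add0r) expr1 expr2 mulrNN mul1r.
rewrite scale1r scaleN1r.
rewrite scale1r; set i0 := widen_ord _ (widen_ord _ _); set i1 := widen_ord _ _.
pose i2 : 'I_3 := ord_max; rewrite -/i2.
have l10 : lift i1 (ord0 : 'I_2) = i0 by apply: val_inj.
have l1m : lift i1 (ord_max : 'I_2) = i2 by apply: val_inj.
have l20 : lift i2 (ord0 : 'I_2) = i0 by apply: val_inj.
have l2m : lift i2 (ord_max : 'I_2) = i1 by apply: val_inj.
rewrite /Ob_fun /contract l10 l1m l20 l2m /upd /=.
by rewrite Ob_cocycle addNr.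
Qed.

Definition obstruction_class E (s : linear_section E) (phig : Der g)
    (phia : Der a) : cohomology g a 2 :=
  cohomology_class (MkCocycle (Ob_cochain_cocycle s phig phia)).

(* Statements quantifying over all linear sections are thus never vacuous. *)
Lemma linear_section_exists E : inhabited (linear_section E).
Proof.
set p := ext_p E.
pose P (W : set h) := (forall c u v, W u -> W v -> W (c *: u + v)) /\
  (forall u, W u -> p u = 0 -> u = 0).
have [F FP Ftot|M [[Mlin Mker] Mmax]] := @Zorn_bigcup _ P.
  split=> [c u v [X FX Xu] [Y FY Yv]|u [X FX Xu]]; last exact: (FP X FX).2.
  have [XY|YX] := Ftot X Y FX FY.
    by exists Y => //; apply: (FP Y FY).1 => //; apply: XY.
  by exists X => //; apply: (FP X FX).1 => //; apply: YX.
have M0 : M 0.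
  apply: contrapT => M0.
  have Mempty u : ~ M u.
    by move=> Mu; apply: M0; rewrite -(addNr u) -scaleN1r; apply: Mlin.
  apply: (Mmax [set (0 : h)]); first by split=> [u /Mempty //|/(_ 0 erefl)].
  by split=> [c u v -> ->|u]; rewrite ?scaler0 ?addr0.
have MZ c u : M u -> M (c *: u) by move=> Mu; rewrite -[_ *: _]addr0; apply: Mlin.
have Msurj x : exists w, M w /\ p w = x.
  apply: contrapT => Mx; have [y yx] := ext_p_surj E x.
  pose B : set h := [set z | exists c w, M w /\ z = c *: y + w].
  apply: (Mmax B); split.
  - by move=> w Mw; exists 0, w; rewrite scale0r add0r.
  - move=> BM; apply: Mx; exists y; split=> //.
    by apply: BM; exists 1, 0; rewrite scale1r addr0.
  - move=> c _ _ [c1 [w1 [Mw1 ->]]] [c2 [w2 [Mw2 ->]]].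
    exists (c * c1 + c2), (c *: w1 + w2); split; first exact: Mlin.
    by rewrite scalerDr scalerA addrACA scalerDl.
  - move=> _ [c [w [Mw ->]]]; have [->|c0] := eqVneq c 0.
      by rewrite scale0r add0r; apply: Mker.
    rewrite linearP yx => /eqP; rewrite addrC addr_eq0 => /eqP pw.
    case: Mx; exists (- c^-1 *: w); split; first exact: MZ.
    by rewrite linearZ /= pw scaleNr scalerN opprK scalerA mulVf // scale1r.
pose s x := xget 0 [set w | M w /\ p w = x].
have sP x : M (s x) /\ p (s x) = x.
  by rewrite /s; case: xgetP => [w _ //|Mx]; have [w wP] := Msurj x; case: (Mx w).
have s_lin : linear s.
  move=> c x y; apply/eqP; rewrite -subr_eq0; apply/eqP/Mker.
    rewrite [s _ - _]addrC -scaleN1r; apply: (Mlin); last exact: (sP _).1.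
    by apply: Mlin; apply: (sP _).1.
  by rewrite raddfB /= linearP !(sP _).2 subrr.
pose sl : {linear g -> h} := HB.pack s (GRing.isLinear.Build K g h *:%R s s_lin).
by constructor; exists sl => x; exact: (sP x).2.
Qed.

End Obstruction.

(* Main.v *)
Require Import Defs.
From mathcomp Require Import all_boot all_order all_algebra.
From HB Require Import structures.
From mathcomp Require Import ring_quotient boolp.

Import GRing.Theory.
Local Open Scope ring_scope.

(** Fix the section s.  In h every element splits as y = i (r y) + s (p y), and
    since i(a) is central, brackets in h only see the images in g:
    [y, z] = [s (p y), s (p z)] = i (psi (p y) (p z)) + s [p y, p z].

    A linear endomorphism phih of h compatible with phig and phia is therefore
    determined by the defect lambda : g -> a of its commutation with s, where
    i (lambda x) = phih (s x) - s (phig x), and every linear lambda occurs: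
    phih y = i (phia (r y)) + s (phig (p y)) + i (lambda (p y)).  Comparing the
    components in i(a) of phih [y, z] and of [phih y, z] + [y, phih z] shows that
    phih is a derivation exactly when Ob x y = - lambda [x, y] for all x and y.
    The right-hand side is the coboundary of the 1-cochain lambda, so such a
    lambda exists exactly when the class of Ob vanishes
    ([obstruction_class_eq0]).  Both directions of the theorem need a linear map
    into h with values in ker p to be factored linearly through i, namely
    phih \o s - s \o phig and id - s \o p; this is [ker_factor]. *)

Lemma cohomology_class_eq0 (K : fieldType) (g a : leibnizType K) n
    (z : cocycle g a n) :
  cohomology_class z = 0 <-> is_coboundary z.
Proof.
have piE (x : cocycle g a n) :
    (x - 0 \in @coboundary K g a n) = (cohomology_class x == cohomology_class 0).
  exact: Quotient.idealrBE.
have <- : @cohomology_class K g a n 0 = 0 by exact: raddf0.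
split=> [/eqP|zB]; first by rewrite -piE subr0 => /asboolP.
by apply/eqP; rewrite -piE subr0; apply/asboolP.
Qed.

Lemma delta1E (K : fieldType) (g a : leibnizType K) (c : cochain g a 1)
    (x : 'I_2 -> g) :
  delta c x = - c (fun=> bracket (x ord0) (x ord_max)).
Proof.
rewrite /= /delta_fun; under eq_bigr do rewrite big_mkcond.
rewrite !big_ord_recr !big_ord0 /= !(addr0, add0r) expr1 scaleN1r.
congr (- c _); apply/funext => k.
have -> : widen_ord (leqnSn 1) ord_max = ord0 :> 'I_2 by apply: val_inj.
rewrite /contract /upd.
by have -> : lift ord_max k = ord0 :> 'I_2 by apply: val_inj; rewrite ord1.
Qed.

Lemma cochain1_linear (K : fieldType) (g a : leibnizType K)
    (c : cochain g a 1) :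
  linear (fun x => c (fun=> x)).
Proof.
have /asboolP cP := cochainP c.
have updE (u : g) : upd (fun=> 0) ord0 u = (fun=> u) :> ('I_1 -> g).
  by apply/funext => k; rewrite /upd ord1.
by move=> k u v; have := cP (fun=> 0) ord0 k u v; rewrite !updE.
Qed.

Lemma linear_cochain1 (K : fieldType) (g a : leibnizType K)
    (f : {linear g -> a}) :
  multilinearb (fun x : 'I_1 -> g => f (x ord0)).
Proof. by apply/asboolP => x k c u v; rewrite /upd (ord1 k) /= linearP. Qed.

(** By [delta1E] the differential of a linear map f is (x, y) |-> - f [x, y], and
    1-cochains are the same as linear maps. *)
Lemma obstruction_class_eq0 (K : fieldType) (a h g : leibnizType K)
    (E : central_extension a h g) (s : linear_section E)
    (phig : Der g) (phia : Der a) :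
  obstruction_class s phig phia = 0 <->
  exists f : {linear g -> a}, forall x y,
    Ob s phig phia x y = - f (bracket x y).
Proof.
split=> [/cohomology_class_eq0 /= [c cE]|[f fE]].
  pose f0 x := c (fun=> x).
  pose f : {linear g -> a} :=
    HB.pack f0 (GRing.isLinear.Build K g a *:%R f0 (cochain1_linear K g a c)).
  exists f => x y.
  pose xy (k : 'I_2) := if k == ord0 then x else y.
  have := congr1 (fun z : cochain g a 2 => z xy) cE.
  by rewrite delta1E.
apply/cohomology_class_eq0; exists (MkCochain (linear_cochain1 K g a f)).
apply/val_inj/funext => x; rewrite /=.
by have /= -> := delta1E _ _ _ (MkCochain (linear_cochain1 K g a f)) x; rewrite -fE.
Qed.

(** By exactness values exist pointwise; injectivity of i makes the resulting
    choice linear. *)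
Lemma ker_factor (K : fieldType) (V : lmodType K) (a h g : leibnizType K)
    (E : central_extension a h g) (f : {linear V -> h}) :
  (forall v, ext_p E (f v) = 0) ->
  exists f' : {linear V -> a}, forall v, ext_i E (f' v) = f v.
Proof.
move=> pf0.
have /choice[f' f'E] v : exists u, ext_i E u = f v by apply/ext_exact/pf0.
have f'_lin : linear f'.
  by move=> c u v; apply: (@ext_i_inj _ _ _ _ E); rewrite linearP !f'E linearP.
pose l : {linear V -> a} :=
  HB.pack f' (GRing.isLinear.Build K V a *:%R f' f'_lin).
by exists l.
Qed.

Section SectionTheory.
Context {K : fieldType} {a h g : leibnizType K}.
Variables (E : central_extension a h g) (s : linear_section E).

Lemma section_retraction :
  exists r : {linear h -> a}, forall y, y = ext_i E (r y) + s (ext_p E y).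
Proof.
pose f0 y := y - s (ext_p E y).
have f0_lin : linear f0.
  by move=> c u v; rewrite /f0 !linearP /= addrACA -scalerDr.
pose f : {linear h -> h} :=
  HB.pack f0 (GRing.isLinear.Build K h h *:%R f0 f0_lin).
have [|r rE] := @ker_factor _ _ _ _ _ E f.
  by move=> y; rewrite linearB /= sectionP subrr.
by exists r => y; rewrite rE subrK.
Qed.

Lemma bracket_section x y :
  bracket (s x) (s y) = ext_i E (psi s x y) + s (bracket x y).
Proof. by rewrite psiP subrK. Qed.

(** The difference of y and s (p y) lies in i(a), which is central. *)
Lemma bracket_projl y z : bracket y z = bracket (s (ext_p E y)) z.
Proof.
by have [r rE] := section_retraction; rewrite {1}(rE y) bracketDl ext_centrall
  add0r.
Qed.

Lemma bracket_projr y z : bracket y z = bracket y (s (ext_p E z)).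
Proof.
by have [r rE] := section_retraction; rewrite {1}(rE z) bracketDr ext_centralr
  add0r.
Qed.

(** The primitive is the defect f with i (f x) = phih (s x) - s (phig x). *)
Lemma extensible_primitive (phig : Der g) (phia : Der a) :
  extensible E phig phia ->
  exists f : {linear g -> a}, forall x y,
    Ob s phig phia x y = - f (bracket x y).
Proof.
move=> [phih [phih_i phih_p]].
pose d0 x := phih (s x) - s (phig x).
have d0_lin : linear d0.
  by move=> c u v; rewrite /d0 !linearP /= addrACA -scalerDr.
pose d : {linear g -> h} :=
  HB.pack d0 (GRing.isLinear.Build K g h *:%R d0 d0_lin).
have [|f fE] := @ker_factor _ _ _ _ _ E d.
  by move=> x; rewrite linearB /= phih_p !sectionP subrr.
have phih_s x : phih (s x) = ext_i E (f x) + s (phig x) by rewrite fE subrK.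
exists f => x y; apply: (@ext_i_inj _ _ _ _ E).
(* Both evaluations of phih on [s x, s y]. *)
have := derP phih (s x) (s y).
rewrite {1}bracket_section linearD /= phih_i !phih_s derP linearD.
rewrite bracketDl bracketDr ext_centrall ext_centralr !add0r !bracket_section.
rewrite [RHS]addrACA [LHS]addrA => /addIr phihE.
by rewrite /Ob !linearB /= linearN -addrA -opprD -phihE opprD addrA subrr add0r.
Qed.

(** The extension acts as phia on i(a), and on s(g) as phig corrected by i \o f.
    Since phi lifts phig and brackets only depend on projections to g, in
    [phi y, z] + [y, phi z] the element phi y may be replaced by s (phig (p y)),
    so f enters the derivation identity only through phi [y, z]. *)
Lemma primitive_extensible (phig : Der g) (phia : Der a) (f : {linear g -> a}) :
  (forall x y, Ob s phig phia x y = - f (bracket x y)) ->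
  extensible E phig phia.
Proof.
move=> fE; have [r rE] := section_retraction.
pose p := ext_p E.
have pi u : p (ext_i E u) = 0 by apply/ext_exact; exists u.
have ri u : r (ext_i E u) = u.
  apply: (@ext_i_inj _ _ _ _ E).
  by rewrite [RHS]rE -/p pi linear0 addr0.
have r_bracket y z : r (bracket y z) = psi s (p y) (p z).
  apply: (@ext_i_inj _ _ _ _ E); apply: (addIr (s (p (bracket y z)))).
  rewrite -rE /p ext_p_morph -bracket_section.
  by rewrite [LHS]bracket_projl [LHS]bracket_projr.
pose phi y := ext_i E (phia (r y) + f (p y)) + s (phig (p y)).
have phi_lin : linear phi.
  by move=> c u v; rewrite /phi !linearP /= addrACA -scalerDr linearP addrACA
    -scalerDr.
have p_phi y : p (phi y) = phig (p y).
  by rewrite /phi linearD /= pi add0r /p sectionP.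
pose phil : {linear h -> h} :=
  HB.pack phi (GRing.isLinear.Build K h h *:%R phi phi_lin).
have phi_der : derivation phil.
  move=> y z /=.
  rewrite [bracket (phi y) z]bracket_projl [bracket (s _) z]bracket_projr.
  rewrite [bracket y (phi z)]bracket_projl [bracket (s _) (phi z)]bracket_projr.
  rewrite -/p !p_phi !bracket_section addrACA -!linearD /= -derP.
  rewrite /phi r_bracket /p ext_p_morph -/p; congr (ext_i E _ + _).
  (* What remains is the hypothesis on Ob at (p y, p z), with terms moved. *)
  have /eqP := fE (p y) (p z).
  by rewrite /Ob -addrA -opprD subr_eq addrC => /eqP ->; rewrite subrK.
exists (MkDer phi_der); split=> [u|y] /=; last exact: p_phi.
by rewrite /phi ri pi !linear0 !addr0.
Qed.

End SectionTheory.

Theorem theorem4p6 (K : fieldType) (K_char0 : [pchar K] =i pred0)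
    (a h g : leibnizType K) (E : central_extension a h g)
    (phig : Der g) (phia : Der a) (s : linear_section E) :
  extensible E phig phia <-> obstruction_class s phig phia = 0.
Proof.
split=> [/(@extensible_primitive _ _ _ _ _ s)/obstruction_class_eq0 //|].
by move=> /obstruction_class_eq0[f]; apply: primitive_extensible.
Qed.
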